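(* Let $x_0,\dots,x_m\in\mathbb{C}^n$, let $X=[x_0\ \cdots\ x_{m-1}]$, $Y=[x_1\ \cdots\ x_m]$, and let $A=YX^+$ be the system matrix to the data. Let $r=\operatorname{rank}(X)$ and let DMD eigenvalues $\lambda_1,\dots,\lambda_r$ and DMD modes $\vartheta_1,\dots,\vartheta_r$ be given by SVD-Dynamic Mode Decomposition (SDMD) applied to $x_0,\dots,x_m$. Let $q=x_m-Xc$ with $c=X^+x_m$. Then for every $i$ with $\lambda_i\neq0$, the vector $$\zeta_i=\vartheta_i+\frac1{\lambda_i}\langle e_m,X^+\vartheta_i\rangle\cdot q$$ is an eigenvector of the system matrix $A$ to the eigenvalue $\lambda_i$.
   Context: $M^+$ denotes the Moore-Penrose pseudoinverse and $M^*$ the conjugate transpose of a matrix $M$. $e_m$ is the last standard basis vector of $\mathbb{C}^m$ and $\langle e_m,w\rangle=e_m^Tw$ is the last entry of $w\in\mathbb{C}^m$. SDMD applied to data $x_0,\dots,x_m\in\mathbb{C}^n$: with $X=[x_0\ \cdots\ x_{m-1}]$, $Y=[x_1\ \cdots\ x_m]\in\mathbb{C}^{n\times m}$ and $r=\operatorname{rank}(X)$, take a reduced singular value decomposition $X=U\Sigma V^*$ ($U\in\mathbb{C}^{n\times r}$ and $V\in\mathbb{C}^{m\times r}$ with orthonormal columns, $\Sigma\in\mathbb{R}^{r\times r}$ diagonal with positive diagonal entries). The DMD matrix is $S=U^*YV\Sigma^{-1}\in\mathbb{C}^{r\times r}$. The DMD eigenvalues are the eigenvalues $\lambda_1,\dots,\lambda_r$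 of $S$, with chosen eigenvectors $v_i$ ($Sv_i=\lambda_iv_i$, $v_i\neq0$). The DMD modes are $\vartheta_i=Uv_i\in\mathbb{C}^n$. *)

(* Defs.v *)
From mathcomp Require Import all_boot all_order all_algebra.
From mathcomp Require Import reals complex.

Set Implicit Arguments.
Unset Strict Implicit.
Unset Printing Implicit Defensive.

Import Order.TTheory GRing.Theory Num.Theory.

Local Open Scope ring_scope.
Local Open Scope sesquilinear_scope.
Local Open Scope complex_scope.

Definition is_mppinv (C : numClosedFieldType) (p q : nat)
    (M : 'M[C]_(p, q)) (P : 'M[C]_(q, p)) : bool :=
  [&& M *m P *m M == M, P *m M *m P == P,
      (M *m P)^t* == M *m P & (P *m M)^t* == P *m M].

Lemma adjmxM (C : numClosedFieldType) (p q s : nat)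
    (A : 'M[C]_(p, q)) (B : 'M[C]_(q, s)) : (A *m B)^t* = B^t* *m A^t*.
Proof. by rewrite trmx_mul map_mxM. Qed.

Lemma adjmxK (C : numClosedFieldType) (p q : nat) (A : 'M[C]_(p, q)) :
  A^t*^t* = A.
Proof. by apply/matrixP => i j; rewrite !mxE conjCK. Qed.

Lemma adjmx1 (C : numClosedFieldType) (p : nat) : (1%:M : 'M[C]_p)^t* = 1%:M.
Proof. by rewrite trmx1 map_mx1. Qed.

Lemma gram_eq0 (C : numClosedFieldType) (p q : nat) (A : 'M[C]_(p, q)) :
  A *m A^t* = 0 -> A = 0.
Proof.
move=> A0; apply/matrixP => i j; rewrite [RHS]mxE.
have /eqP := congr1 (fun B : 'M_p => B i i) A0.
rewrite !mxE psumr_eq0 => [/allP/(_ j)|k _]; last first.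
  by rewrite !mxE mul_conjC_ge0.
by rewrite mem_index_enum !mxE mul_conjC_eq0 => /(_ isT)/eqP.
Qed.

Lemma gram_unit (C : numClosedFieldType) (p q : nat) (A : 'M[C]_(p, q)) :
  row_free A -> A *m A^t* \in unitmx.
Proof.
move=> Afree; rewrite -row_free_unit -kermx_eq0; apply/eqP.
set K := kermx _.
have KA0 : K *m A = 0.
  apply: gram_eq0; rewrite adjmxM mulmxA -(mulmxA K).
  by rewrite mulmx_ker mul0mx.
by apply: (row_free_inj Afree); rewrite KA0 mul0mx.
Qed.

Lemma adj_invmx_herm (C : numClosedFieldType) (p : nat) (G : 'M[C]_p) :
  G^t* = G -> (invmx G)^t* = invmx G.
Proof. by move=> GH; rewrite trmx_inv map_invmx GH. Qed.

(* From a full-rank factorization M = L *m N,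
   M^+ = N^* (N N^* )^-1 (L^* L)^-1 L^*. *)
Lemma mppinv_factor (C : numClosedFieldType) (p q r : nat)
    (L : 'M[C]_(p, r)) (N : 'M[C]_(r, q)) :
  row_full L -> row_free N ->
  is_mppinv (L *m N)
    (N^t* *m invmx (N *m N^t*) *m (invmx (L^t* *m L) *m L^t*)).
Proof.
move=> Lfull Nfree.
have NU : N *m N^t* \in unitmx by apply: gram_unit.
have LU : L^t* *m L \in unitmx.
  rewrite -{2}[L]adjmxK; apply: gram_unit.
  by rewrite /row_free mxrank_map mxrank_tr.
set GN := N *m N^t* in NU *; set GL := L^t* *m L in LU *.
have GNH : (invmx GN)^t* = invmx GN.
  by apply: adj_invmx_herm; rewrite adjmxM adjmxK.
have GLH : (invmx GL)^t* = invmx GL.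
  by apply: adj_invmx_herm; rewrite adjmxM adjmxK.
set P := _ *m (_ *m _).
have MP : L *m N *m P = L *m invmx GL *m L^t*.
  rewrite /P -!mulmxA (mulmxA N (N^t*)) -/GN.
  by rewrite (mulmxA GN) mulmxV // mul1mx.
have PM : P *m (L *m N) = N^t* *m invmx GN *m N.
  rewrite /P -!mulmxA (mulmxA (L^t*) L) -/GL.
  by rewrite (mulmxA (invmx GL)) mulVmx // mul1mx.
apply/and4P; split; apply/eqP.
- rewrite MP -!mulmxA (mulmxA (L^t*) L) -/GL.
  by rewrite (mulmxA (invmx GL)) mulVmx // mul1mx.
- rewrite PM /P -!mulmxA (mulmxA N (N^t*)) -/GN.
  by rewrite (mulmxA GN) mulmxV // mul1mx.
- by rewrite MP !adjmxM adjmxK GLH mulmxA.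
- by rewrite PM !adjmxM adjmxK GNH mulmxA.
Qed.

Lemma mppinv_exists (C : numClosedFieldType) (p q : nat) (M : 'M[C]_(p, q)) :
  exists P, is_mppinv M P.
Proof.
have := mppinv_factor (col_base_full M) (row_base_free M).
by rewrite mulmx_base => MP; eexists; apply: MP.
Qed.

Lemma mppinv_uniq (C : numClosedFieldType) (p q : nat) (M : 'M[C]_(p, q))
    (P Q : 'M[C]_(q, p)) : is_mppinv M P -> is_mppinv M Q -> P = Q.
Proof.
move=> /and4P[/eqP P1 /eqP P2 /eqP P3 /eqP P4].
move=> /and4P[/eqP Q1 /eqP Q2 /eqP Q3 /eqP Q4].
have MPQ : M *m P = M *m Q.
  by rewrite -P3 -{1}Q1 -mulmxA adjmxM P3 Q3 mulmxA P1.
have PQM : P *m M = Q *m M.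
  rewrite -P4 -{1}Q1 -!mulmxA mulmxA adjmxM P4 Q4.
  by rewrite -mulmxA (mulmxA M P M) P1.
by rewrite -P2 PQM -mulmxA MPQ mulmxA Q2.
Qed.

Definition mppinv (C : numClosedFieldType) (p q : nat) (M : 'M[C]_(p, q)) :
  'M[C]_(q, p) := xchoose (mppinv_exists M).

Lemma mppinvP (C : numClosedFieldType) (p q : nat) (M : 'M[C]_(p, q)) :
  is_mppinv M (mppinv M).
Proof. exact: xchooseP. Qed.

(* MathComp's [eigenvalue] and [eigenspace] act on row vectors; here A acts on
   column vectors. *)
Definition is_eigenvector (F : fieldType) (p : nat) (A : 'M[F]_p) (a : F)
    (v : 'cV[F]_p) : Prop := v != 0 /\ A *m v = a *: v.

(* For m = 0 this is the empty vector. *)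
Definition e_last (F : fieldType) (m : nat) : 'cV[F]_m :=
  \col_(i < m) (i.+1 == m)%:R.

Definition dataX (F : fieldType) (n m : nat) (x : 'I_m.+1 -> 'cV[F]_n) :
  'M[F]_(n, m) := \matrix_(i < n, j < m) x (widen_ord (leqnSn m) j) i 0.

Definition dataY (F : fieldType) (n m : nat) (x : 'I_m.+1 -> 'cV[F]_n) :
  'M[F]_(n, m) := \matrix_(i < n, j < m) x (lift ord0 j) i 0.

Definition system_matrix (C : numClosedFieldType) (n m : nat)
    (x : 'I_m.+1 -> 'cV[C]_n) : 'M[C]_n := dataY x *m mppinv (dataX x).

Definition reduced_svd (R : realType) (n m : nat) (X : 'M[R[i]]_(n, m))
    (U : 'M[R[i]]_(n, \rank X)) (Sigma : 'M[R]_(\rank X))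
    (V : 'M[R[i]]_(m, \rank X)) : Prop :=
  [/\ U^t* *m U = 1%:M,
      V^t* *m V = 1%:M,
      is_diag_mx Sigma,
      forall i, 0 < Sigma i i &
      X = U *m map_mx (real_complex R) Sigma *m V^t*].

Definition dmd_matrix (R : realType) (n m r : nat) (Y : 'M[R[i]]_(n, m))
    (U : 'M[R[i]]_(n, r)) (Sigma : 'M[R]_r) (V : 'M[R[i]]_(m, r)) :
  'M[R[i]]_r := U^t* *m Y *m V *m invmx (map_mx (real_complex R) Sigma).

Arguments reduced_svd {R n m} X U Sigma V.

(* [lam] lists the eigenvalues of the DMD matrix with algebraic multiplicity,
   which is why its characteristic polynomial is prescribed. The reduced SVD
   and the eigenvectors v_i are arbitrary admissible choices. *)
Definition sdmd (R : realType) (n m : nat) (x : 'I_m.+1 -> 'cV[R[i]]_n)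
    (lam : 'I_(\rank (dataX x)) -> R[i])
    (theta : 'I_(\rank (dataX x)) -> 'cV[R[i]]_n) : Prop :=
  exists U Sigma V, exists v : 'I_(\rank (dataX x)) -> 'cV[R[i]]_(\rank (dataX x)),
    let S := dmd_matrix (dataY x) U Sigma V in
    [/\ reduced_svd (dataX x) U Sigma V,
        char_poly S = \prod_i ('X - (lam i)%:P),
        forall i, is_eigenvector S (lam i) (v i) &
        forall i, theta i = U *m v i].

Arguments sdmd {R n m} x lam theta.

(* Main.v *)
Require Import Defs.
From mathcomp Require Import all_boot all_order all_algebra.
From mathcomp Require Import reals complex.

(** Let [P] be the pseudoinverse of [X], so that [X *m P] is the orthogonal
    projection onto the column space of [X] and [A = Y *m P].  The singular
    value decomposition gives [P = V Sigma^-1 U^*] ([mppinv_svd]) and hence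
    [X *m P = U U^*].  For [theta = U v] with [S v = lambda v] this yields
    [X P A theta = U S v = lambda theta]: a DMD mode satisfies the eigenvalue
    equation up to the component of [A theta] orthogonal to the column space
    of [X].

    That component has a fixed direction.  All columns of [Y] but the last are
    columns of [X], so removing from [Y] its projection leaves the rank-one
    matrix [q e_m^T] ([dataY_residual]).  Therefore
    [A theta = lambda theta + <e_m, P theta> q = lambda zeta].  Since [q] is
    orthogonal to the column space of [X], it satisfies [P q = 0]; thus [A]
    does not see the correction, [A zeta = A theta = lambda zeta], and
    [X P zeta = theta != 0] shows that [zeta] is nonzero. *)

Set Implicit Arguments.
Unset Strict Implicit.
Unset Printing Implicit Defensive.

Import Order.TTheory GRing.Theory Num.Theory.

Local Open Scope ring_scope.
Local Open Scope sesquilinear_scope.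
Local Open Scope complex_scope.

Lemma mulmx_mppinvK (C : numClosedFieldType) (p q : nat) (M : 'M[C]_(p, q)) :
  M *m mppinv M *m M = M.
Proof. by have /and4P[/eqP] := mppinvP M. Qed.

Lemma mppinv_mulmxK (C : numClosedFieldType) (p q : nat) (M : 'M[C]_(p, q)) :
  mppinv M *m M *m mppinv M = mppinv M.
Proof. by have /and4P[_ /eqP] := mppinvP M. Qed.

(** The middle factor [D] may be any invertible matrix: [M *m P] and [P *m M]
    collapse to [U U^*] and [V V^*], which are Hermitian whatever [D] is. *)
Lemma mppinv_svd (C : numClosedFieldType) (p q r : nat)
    (U : 'M[C]_(p, r)) (D : 'M[C]_r) (V : 'M[C]_(q, r)) :
  U^t* *m U = 1%:M -> V^t* *m V = 1%:M -> D \in unitmx ->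
  mppinv (U *m D *m V^t*) = V *m invmx D *m U^t*.
Proof.
move=> UU VV Du; apply: mppinv_uniq (mppinvP _) _.
set M := U *m D *m V^t*; set P := V *m invmx D *m U^t*.
have MP : M *m P = U *m U^t*.
  rewrite /M /P -!mulmxA (mulmxA (V^t*) V) VV mul1mx.
  by rewrite (mulmxA D) mulmxV // mul1mx.
have PM : P *m M = V *m V^t*.
  rewrite /M /P -!mulmxA (mulmxA (U^t*) U) UU mul1mx.
  by rewrite (mulmxA (invmx D)) mulVmx // mul1mx.
apply/and4P; split; apply/eqP.
- by rewrite MP /M -!mulmxA (mulmxA (U^t*) U) UU mul1mx.
- by rewrite PM /P -!mulmxA (mulmxA (V^t*) V) VV mul1mx.
- by rewrite MP adjmxM adjmxK.
- by rewrite PM adjmxM adjmxK.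
Qed.

(** The two data matrices are shifts of each other, so a left multiplication
    that annihilates [X] annihilates all columns of [Y] but the last. *)
Lemma mulmx_dataY (F : fieldType) (n m p : nat) (x : 'I_m.+1 -> 'cV[F]_n)
    (Q : 'M[F]_(p, n)) :
  Q *m dataX x = 0 -> Q *m dataY x = Q *m x ord_max *m (e_last F m)^T.
Proof.
move=> QX0.
have Qx0 (k : 'I_m.+1) : (k < m)%N -> Q *m x k = 0.
  move=> km; apply/matrixP => i j; rewrite ord1 [RHS]mxE.
  have := congr1 (fun B : 'M_(p, m) => B i (Ordinal km)) QX0.
  rewrite [in RHS]mxE => QXik; rewrite -{}QXik !mxE.
  apply: eq_bigr => l _; rewrite !mxE.
  by congr (_ * x _ _ _); apply: val_inj.
apply/matrixP => i j.
transitivity ((Q *m x (lift ord0 j)) i 0).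
  by rewrite !mxE; apply: eq_bigr => l _; rewrite !mxE.
rewrite [RHS]mxE big_ord1 [_^T _ _]mxE [e_last _ _ _ _]mxE.
have [jm|jm] := eqVneq j.+1 m.
  by rewrite mulr1; congr ((Q *m x _) i 0); apply: val_inj.
rewrite mulr0 Qx0 ?mxE //.
by rewrite lift0 ltn_neqAle jm ltn_ord.
Qed.

Lemma dataY_residual (C : numClosedFieldType) (n m : nat)
    (x : 'I_m.+1 -> 'cV[C]_n) :
  let X := dataX x in
  let q := x ord_max - X *m (mppinv X *m x ord_max) in
  dataY x = X *m mppinv X *m dataY x + q *m (e_last _ m)^T.
Proof.
move=> X q.
have QX0 : (1%:M - X *m mppinv X) *m dataX x = 0.
  by rewrite mulmxBl mul1mx mulmx_mppinvK subrr.
have := mulmx_dataY QX0; rewrite !mulmxBl !mul1mx -(mulmxA X _ (x ord_max)).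
by rewrite -mulmxBl -/q => <-; rewrite addrC subrK.
Qed.

(** The correction step, for a vector of the column space of [X] that is an
    eigenvector of the system matrix compressed to that space. *)
Lemma system_eigenvector_correction (C : numClosedFieldType) (n m : nat)
    (x : 'I_m.+1 -> 'cV[C]_n) (a : C) (t : 'cV[C]_n) :
  let X := dataX x in
  let q := x ord_max - X *m (mppinv X *m x ord_max) in
  a != 0 -> X *m mppinv X *m t = t ->
  is_eigenvector (X *m mppinv X *m system_matrix x) a t ->
  is_eigenvector (system_matrix x) a
    (t + (a^-1 * ((e_last _ m)^T *m (mppinv X *m t)) 0 0) *: q).
Proof.
move=> X q a0 Xt [t0 At].
have Pq : mppinv X *m q = 0.
  by rewrite /q mulmxBr !mulmxA mppinv_mulmxK subrr.
set b := ((e_last _ m)^T *m _) 0 0.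
set z := t + _.
have Pz : mppinv X *m z = mppinv X *m t.
  by rewrite mulmxDr -scalemxAr Pq scaler0 addr0.
split.
  apply: contraNneq t0 => z0.
  by rewrite -Xt -mulmxA -Pz z0 !mulmx0.
rewrite /system_matrix -mulmxA Pz dataY_residual mulmxDl.
rewrite -[X in _ + X]mulmxA [(e_last _ m)^T *m _]mx11_scalar -/X -/q -/b.
rewrite mul_mx_scalar -(mulmxA (X *m _)) (mulmxA (dataY x)) mulmxA At.
by rewrite /z [RHS]scalerDr scalerA mulrA mulfV // mul1r.
Qed.

Lemma diag_pos_unitmx (R : realFieldType) (r : nat) (D : 'M[R]_r) :
  is_diag_mx D -> (forall i, 0 < D i i) -> D \in unitmx.
Proof.
move=> Ddiag Dpos; rewrite unitmxE det_trig ?is_diag_mx_is_trig // unitfE.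
by rewrite gt_eqF // prodr_gt0.
Qed.

Theorem theorem5p9 (R : realType) (n m : nat) (x : 'I_m.+1 -> 'cV[R[i]]_n)
    (lam : 'I_(\rank (dataX x)) -> R[i])
    (theta : 'I_(\rank (dataX x)) -> 'cV[R[i]]_n) :
  sdmd x lam theta ->
  let X := dataX x in
  let c := mppinv X *m x ord_max in
  let q := x ord_max - X *m c in
  forall i, lam i != 0 ->
    let zeta := theta i
      + ((lam i)^-1 * ((e_last _ m)^T *m (mppinv X *m theta i)) 0 0) *: q in
    is_eigenvector (system_matrix x) (lam i) zeta.
Proof.
move=> [U [Sigma [V [v]]]] /= [[UU VV Sdiag Spos XE] _ Sv thetaE] i lam0.
have [v0 Svi] := Sv i.
set D := map_mx (real_complex R) Sigma in XE.
have Du : D \in unitmx by rewrite map_unitmx diag_pos_unitmx.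
have PE : mppinv (dataX x) = V *m invmx D *m U^t*.
  by rewrite [X in mppinv X]XE mppinv_svd.
have XP : dataX x *m mppinv (dataX x) = U *m U^t*.
  rewrite PE [X in X *m _ = _]XE -!mulmxA (mulmxA (V^t*) V) VV mul1mx.
  by rewrite (mulmxA D) mulmxV // mul1mx.
have UUv : U^t* *m theta i = v i by rewrite thetaE mulmxA UU mul1mx.
apply: system_eigenvector_correction => //.
  by rewrite XP -mulmxA UUv thetaE.
split.
  by apply: contraNneq v0 => theta0; rewrite -UUv theta0 mulmx0.
rewrite XP /system_matrix PE thetaE scalemxAr -Svi.
by rewrite /dmd_matrix -!mulmxA (mulmxA (U^t*) U) UU mul1mx.
Qed.
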